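(* Let $k\ge 2$ and $n\ge 1$ be integers, let $t=(t_1,\dots,t_k)$ be complex numbers with $t_2\neq 0$, and put $t_0=1$. Let $\mathrm{i}=\sqrt{-1}$ and let $C_{k,n}=(c_{rs})$ be the $n\times n$ lower Hessenberg matrix with $$c_{rs}=\begin{cases}\mathrm{i}^{|r-s|}\,\dfrac{t_{r-s+1}}{t_2^{\,r-s}} & \text{if } s\neq 1 \text{ and } -1\le r-s<k,\\[2mm] \mathrm{i}^{|r-s|}\,\dfrac{t_{r-s+1}}{t_2^{\,r-s}}\,(r-s+1) & \text{if } s=1 \text{ and } -1\le r-s<k,\\[2mm] 0 & \text{otherwise.}\end{cases}$$ Then $\det(C_{k,n})=G_{k,n}(t)$, where $G_{k,n}(t)$ is the generalized Lucas polynomial.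
   Context: The generalized Fibonacci polynomials $F_{k,n}(t)$, $t=(t_1,\dots,t_k)$, are defined by $F_{k,n}(t)=0$ for $n<1$, $F_{k,1}(t)=1$, and $F_{k,n+1}(t)=t_1F_{k,n}(t)+\cdots+t_kF_{k,n-k+1}(t)$ for $n\ge 1$. The generalized Lucas polynomials are given by $G_{k,0}(t)=k$ and $G_{k,n}(t)=\sum_{j=1}^{k} j\,t_j\,F_{k,n-j+1}(t)$ for $n\ge 1$. A matrix $(a_{rs})$ is lower Hessenberg if $a_{rs}=0$ whenever $s-r>1$. *)

(* Defs.v *)
From mathcomp Require Import all_boot all_order all_algebra.
From mathcomp Require Import reals complex.

Set Implicit Arguments.
Unset Strict Implicit.
Unset Printing Implicit Defensive.

Import Order.TTheory GRing.Theory Num.Theory.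
Local Open Scope ring_scope.

(* [tcoef t j] is t_j for t = (t_1, ..., t_k), with t_0 = 1.  It is 0 for
   j > k, an index that never contributes below. *)
Definition tcoef (A : pzRingType) (k : nat) (t : k.-tuple A) (j : nat) : A :=
  (1 :: val t)`_j.

(* The list [:: F_(k,n)(t); ...; F_(k,1)(t)]; reading it with default value 0
   accounts for the indices below 1. *)
Fixpoint genFib_hist (A : pzRingType) (k : nat) (t : k.-tuple A) (n : nat) :
    seq A :=
  match n with
  | 0 => [::]
  | 1 => [:: 1]
  | m.+1 => let s := genFib_hist t m in
            (\sum_(1 <= j < k.+1) tcoef t j * s`_(j.-1)) :: s
  end.

Definition genFib (A : pzRingType) (k : nat) (t : k.-tuple A) (n : int) : A :=
  match n with
  | Posz m => (genFib_hist t m)`_0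
  | Negz _ => 0
  end.

Definition genLucas (A : pzRingType) (k : nat) (t : k.-tuple A) (n : nat) : A :=
  if n == 0%N then k%:R
  else \sum_(1 <= j < k.+1) j%:R * tcoef t j * genFib t (n%:Z - j%:Z + 1).

Definition lower_hessenberg (A : pzRingType) (n : nat) (M : 'M[A]_n) : Prop :=
  forall r s : 'I_n, s%:Z - r%:Z > 1 -> M r s = 0.

(* Rows and columns are numbered from 0, so the column s = 1 of the usual
   numbering is the one with value 0; the difference r - s is unaffected. *)
Definition lucas_mx (R : realType) (k n : nat) (t : k.-tuple R[i]) :
    'M[R[i]]_n :=
  \matrix_(r < n, s < n)
    let d : int := r%:Z - s%:Z in
    if (-1 <= d) && (d < k%:Z) then
      let c := 'i%C ^+ `|d|%N * (tcoef t `|(d + 1)%R|%N / tcoef t 2 ^ d) in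
      if s == 0%N :> nat then c * (d + 1)%:~R else c
    else 0.

Section Facts.
Variables (A : pzRingType) (k : nat) (t : k.-tuple A).

Lemma genFib_lt1 (n : int) : n < 1 -> genFib t n = 0.
Proof. by case: n => [[|n]|n]. Qed.

Lemma genFib1 : genFib t 1 = 1.
Proof. by []. Qed.

Lemma nth_genFib_hist (n j : nat) :
  (genFib_hist t n)`_j = genFib t (n%:Z - j%:Z).
Proof.
elim: n j => [|n IHn] j; first by case: j => [|j]; rewrite nth_nil.
case: j => [|j]; first by rewrite subr0.
have -> : n.+1%:Z - j.+1%:Z = n%:Z - j%:Z by rewrite !intS opprD addrACA subrr add0r.
rewrite -IHn; case: n {IHn} => [|n] //=.
Qed.

Lemma genFibS (n : int) : 1 <= n ->
  genFib t (n + 1) = \sum_(1 <= j < k.+1) tcoef t j * genFib t (n - j%:Z + 1).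
Proof.
case: n => [[|n]|n] // _.
rewrite -PoszD addn1 [LHS]/=; apply: eq_big_nat => -[|j] // _.
congr (_ * _); rewrite [LHS](nth_genFib_hist n.+1); congr genFib.
by rewrite (intS j) opprD addrA addrAC addrNK.
Qed.

End Facts.

Lemma lucas_mx_hessenberg (R : realType) (k n : nat) (t : k.-tuple R[i]) :
  lower_hessenberg (lucas_mx n t).
Proof.
move=> r s lt_rs; rewrite mxE /= lerNl opprB.
by rewrite leNgt lt_rs.
Qed.

(* Main.v *)
Require Import Defs.
From mathcomp Require Import all_boot all_order all_algebra.
From mathcomp Require Import reals complex.
From mathcomp Require Import zify.

(** Put u = i / t_2.  An entry of the matrix on or below the diagonal is
    u^(r - s) times t_(r - s + 1) (weighted by r - s + 1 in the first column),
    and an entry i t_2 just above the diagonal is u^(-1) times -1.  Conjugating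
    by the diagonal matrix of the powers of u therefore removes i and t_2 and
    leaves a Hessenberg matrix H whose superdiagonal entries are -1 and which,
    outside its first column, is Toeplitz with symbol
    -1 + t_1 z + t_2 z^2 + ... ([lucas_mx_scaling]).

    The Fibonacci polynomials are the coefficients of the power series
    1 / (1 - t_1 z - t_2 z^2 - ...), the opposite of the inverse of that
    symbol.  So multiplying H on the left by the unitriangular Toeplitz matrix
    L of Fibonacci polynomials kills everything outside the first column,
    except the superdiagonal of -1 ([conv_toeplitz_col]), while it turns the
    first column j t_j into the convolution of j t_j with the Fibonacci
    polynomials, that is, into the Lucas polynomials.  The determinant of L *m H
    is read off its last row, where only the corner G_(k,n) survives: its
    cofactor is (-1)^(n-1) times the determinant of - 1%:M of size n - 1
    ([det_bordered_toeplitz]). *)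

Set Implicit Arguments.
Unset Strict Implicit.
Unset Printing Implicit Defensive.

Import Order.TTheory GRing.Theory Num.Theory.
Local Open Scope ring_scope.

Definition toeplitz_hess (A : pzRingType) (a : nat -> A) (r s : nat) : A :=
  if (s <= r)%N then a (r - s)%N else - (s == r.+1)%:R.

Definition bordered_toeplitz (A : pzRingType) (a b : nat -> A) (n : nat) :
    'M[A]_n :=
  \matrix_(r, s) if s == 0%N :> nat then b r else toeplitz_hess a r s.

(** The convolution recurrence for [h] says that its generating series is
    inverse to 1 - z a(z); this is the coefficientwise form of
    h(z) * (z a(z) - 1) = -1.  The sum is entry (r, s + 1) of the product of
    the Toeplitz matrices of h and a. *)
Lemma conv_toeplitz_col (A : comPzRingType) (a h : nat -> A) (r s : nat) :
    h 0%N = 1 -> (forall m, h m.+1 = \sum_(j < m.+1) a j * h (m - j)%N) ->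
  \sum_(m < r.+1) h (r - m)%N * toeplitz_hess a m s.+1 = - (r == s)%:R.
Proof.
move=> h0 hS; have [lt_rs | le_sr] := ltnP r s.
  rewrite (ltn_eqF lt_rs) oppr0 big1 // => m _; rewrite /toeplitz_hess.
  have lt_ms : (m < s)%N by have := ltn_ord m; lia.
  by rewrite leqNgt ltnS ltnW //= eqSS (gtn_eqF lt_ms) oppr0 mulr0.
rewrite -(subnKC le_sr); move: (r - s)%N => q.
rewrite -addnS big_split_ord /= big1 ?add0r => [|m _]; last first.
  rewrite /toeplitz_hess leqNgt ltnS (ltnW (ltn_ord m)) /= eqSS.
  by rewrite (gtn_eqF (ltn_ord m)) oppr0 mulr0.
rewrite big_ord_recl /= addn0 addKn /toeplitz_hess ltnn eqxx mulrN mulr1.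
under eq_bigr => i _.
  rewrite /bump leq0n add1n addnS subnS ltnS leq_addr subSS addKn.
  rewrite subnDl -subnS mulrC.
over.
(* The terms on and below the diagonal rebuild the recurrence for h q, which
   cancels the superdiagonal term - h q; only q = 0 leaves - h 0. *)
case: q => [|q]; first by rewrite h0 big_ord0 addn0 eqxx addr0.
rewrite -{2}(addn0 s) eqn_add2l oppr0 hS addrC.
by under eq_bigr do rewrite subSS; rewrite subrr.
Qed.

(** Multiplying by the unitriangular matrix [L] with entries h (r - m) keeps
    the determinant and replaces the first column by the convolution of [b]
    with [h], all other columns by those of a shifted - 1%:M. *)
Lemma det_bordered_toeplitz (A : comNzRingType) (a b h : nat -> A) (n : nat) :
    h 0%N = 1 -> (forall m, h m.+1 = \sum_(j < m.+1) a j * h (m - j)%N) ->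
  \det (bordered_toeplitz a b n.+1) = \sum_(j < n.+1) b j * h (n - j)%N.
Proof.
move=> h0 hS; set H := bordered_toeplitz a b n.+1.
pose L : 'M[A]_n.+1 :=
  \matrix_(r, m) if (m < r.+1)%N then h (r - m)%N else 0.
have detL : \det L = 1.
  rewrite det_trig; last first.
    by apply/is_trig_mxP => r m lt_rm; rewrite mxE ltnNge lt_rm.
  by apply: big1 => r _; rewrite mxE ltnSn subnn.
have LH (r s : 'I_n.+1) : (L *m H) r s =
    if s == 0%N :> nat then \sum_(j < r.+1) b j * h (r - j)%N
    else - (r.+1 == s)%:R.
  rewrite mxE; transitivity (\sum_(m < r.+1) h (r - m)%N *
      if s == 0%N :> nat then b m else toeplitz_hess a m s).
    rewrite (big_ord_widen n.+1 (fun m => h (r - m)%N *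
      if s == 0%N :> nat then b m else toeplitz_hess a m s)) // [RHS]big_mkcond.
    by apply: eq_bigr => m _; rewrite !mxE; case: ifP; rewrite ?mul0r.
  case: (nat_of_ord s) => [|s'] /=; last by rewrite conv_toeplitz_col.
  by apply: eq_bigr => m _; rewrite mulrC.
(* Expand along the last row: its only nonzero entry is the corner at
   column 0, because row r of L *m H is nonzero only in columns 0 and r + 1. *)
rewrite -[LHS]mul1r -detL -det_mulmx (expand_det_row _ ord_max).
rewrite big_ord_recl /= big1 ?addr0 => [|s _]; last first.
  by rewrite LH lift0 /= eqSS (gtn_eqF (ltn_ord s)) oppr0 mul0r.
rewrite LH /= /cofactor addn0.
have -> : row' ord_max (col' ord0 (L *m H)) = - 1%:M.
  apply/matrixP => r s; rewrite 2![LHS]mxE LH [RHS]mxE [1%:M _ _]mxE !lift0 /=.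
  by rewrite /bump leqNgt ltn_ord add0n eqSS.
by rewrite -scaleN1r detZ det1 mulr1 -expr2 sqrr_sign mulr1.
Qed.

(** Both ranges may be enlarged: [x] vanishes beyond k, and the Fibonacci
    polynomials vanish at the indices below 1. *)
Lemma sum_genFib_trunc (A : pzRingType) (k : nat) (t : k.-tuple A)
    (x : nat -> A) (m : nat) : (forall j, (k < j)%N -> x j = 0) ->
  \sum_(1 <= j < k.+1) x j * genFib t (m.+1%:Z - j%:Z + 1) =
  \sum_(j < m.+1) x j.+1 * genFib t (m - j).+1.
Proof.
move=> x0; rewrite big_add1 big_mkord.
pose N := maxn k m.+1.
rewrite (big_ord_widen N (fun j => x j.+1 * genFib t (m.+1%:Z - j.+1%:Z + 1)))
  ?leq_maxl //.
rewrite (big_ord_widen N (fun j => x j.+1 * genFib t (m - j).+1)) ?leq_maxr //.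
rewrite big_mkcond [RHS]big_mkcond; apply: eq_bigr => j _ /=.
have [lt_jk | le_kj] := ltnP j k; last by rewrite x0 // mul0r if_same.
case: ltnP => [le_jm | lt_mj]; last by rewrite genFib_lt1 ?mulr0 //; lia.
by rewrite (_ : _ - _ + 1 = (m - j).+1%:Z) //; lia.
Qed.

Lemma tcoef_gt (A : pzRingType) (k : nat) (t : k.-tuple A) (j : nat) :
  (k < j)%N -> tcoef t j = 0.
Proof. by move=> lt_kj; rewrite /tcoef nth_default //= size_tuple. Qed.

Lemma genFib_conv (A : pzRingType) (k : nat) (t : k.-tuple A) (m : nat) :
  genFib t m.+2 = \sum_(j < m.+1) tcoef t j.+1 * genFib t (m - j).+1.
Proof.
rewrite -(sum_genFib_trunc t m (@tcoef_gt _ _ t)) -genFibS //.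
by congr genFib; lia.
Qed.

Lemma genLucas_conv (A : pzRingType) (k : nat) (t : k.-tuple A) (m : nat) :
  genLucas t m.+1 =
  \sum_(j < m.+1) j.+1%:R * tcoef t j.+1 * genFib t (m - j).+1.
Proof.
rewrite -(sum_genFib_trunc t m (x := fun j => j%:R * tcoef t j)) // => j lt_kj.
by rewrite tcoef_gt ?mulr0.
Qed.

(** The conjugation by powers of u = i / t_2, written as an exchange so that
    no inverse power is needed.  On and below the diagonal the entries
    are t_(d+1) u^d with d = r - s (times d + 1 in the first column) by
    construction; just above the diagonal the
    sign of -1 comes from i t_2 u = i^2. *)
Lemma lucas_mx_scaling (R : realType) (k n : nat) (t : k.-tuple R[i])
    (r s : 'I_n) : (0 < k)%N -> tcoef t 2 != 0 ->
  lucas_mx n t r s * ('i%C / tcoef t 2) ^+ s =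
  ('i%C / tcoef t 2) ^+ r *
    bordered_toeplitz (fun j => tcoef t j.+1)
      (fun j => j.+1%:R * tcoef t j.+1) n r s.
Proof.
move=> k_gt0 t2; rewrite !mxE /toeplitz_hess /=; set u := 'i%C / _.
have [le_sr | lt_rs] := leqP s r.
  have -> : r%:Z - s%:Z = (r - s)%N by lia.
  have ur : u ^+ r = u ^+ (r - s) * u ^+ s by rewrite -exprD subnK.
  rewrite ltz_nat -PoszD addn1 !absz_nat -exprnP ur /=.
  case: ltnP => [_ | le_k]; last first.
    case: eqP => [s0|_]; last by rewrite tcoef_gt ?mulr0 ?mul0r.
    by rewrite tcoef_gt ?mulr0 ?mul0r //; lia.
  have -> : 'i%C ^+ (r - s) * (tcoef t (r - s).+1 / tcoef t 2 ^+ (r - s))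
      = u ^+ (r - s) * tcoef t (r - s).+1.
    by rewrite expr_div_n mulrA mulrAC.
  case: eqP => [->|_]; last by rewrite mulrAC.
  by rewrite subn0 expr0 !mulr1 -pmulrn mulrAC mulrA.
rewrite (gtn_eqF (leq_ltn_trans (leq0n r) lt_rs)).
have [-> | ne_s] := eqVneq (nat_of_ord s) r.+1; last first.
  by rewrite ifF ?oppr0 ?mul0r ?mulr0 //; lia.
have -> : r%:Z - r.+1%:Z = -1 by lia.
rewrite (_ : _ && _ = true); last by lia.
have uE : 'i%C * tcoef t 2 * u = -1.
  by rewrite /u mulrCA mulfK // -expr2 sqr_i.
rewrite addNr abszN1 expr1 exprN1 invrK absz0 /tcoef /= mul1r.
by rewrite exprS mulrA uE mulN1r mulrN1.
Qed.

Theorem theorem2p2 (R : realType) (k n : nat) (t : k.-tuple R[i])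
  (hk : (2 <= k)%N) (hn : (1 <= n)%N) (ht2 : tcoef t 2 != 0) :
  \det (lucas_mx n t) = genLucas t n.
Proof.
pose u : R[i] := 'i%C / tcoef t 2.
pose D := diag_mx (\row_(r < n) u ^+ r).
have u_neq0 : u != 0.
  by rewrite mulf_neq0 ?invr_eq0 // -sqrf_eq0 sqr_i oppr_eq0 oner_eq0.
have detD : \det D != 0.
  by rewrite det_diag; apply/prodf_neq0 => r _; rewrite mxE expf_neq0.
have scaling : lucas_mx n t *m D =
    D *m bordered_toeplitz (fun j => tcoef t j.+1)
           (fun j => j.+1%:R * tcoef t j.+1) n.
  apply/matrixP => r s; rewrite mul_mx_diag mul_diag_mx [LHS]mxE [RHS]mxE.
  by rewrite ![(\row__ _) _ _]mxE lucas_mx_scaling // ltnW.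
apply: (mulIf detD); rewrite -det_mulmx scaling det_mulmx mulrC; congr (_ * _).
case: n hn {D detD scaling} => [//|n] _.
rewrite (@det_bordered_toeplitz _ _ _ (fun m => genFib t m.+1)) //.
  by rewrite genLucas_conv.
exact: genFib_conv.
Qed.
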